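(* Let $G$ be a graph of order $n$ with minimum degree $\delta>0$ and matching number $\beta_1=\beta_1(G)$. Then $$ \gamma_r(G)\le\frac{2\ln(\delta+1)+\delta+3}{\delta+1}\,n-2\beta_1 $$ and $$ \gamma_{\mathrm{tr}}(G)\le\frac{2\ln\delta+\delta+2}{\delta}\,n-2\beta_1 . $$
   Context: All graphs are finite and undirected, without loops or multiple edges. The matching number $\beta_1(G)$ is the largest number of pairwise non-adjacent edges in $G$. A set $X\subseteq V(G)$ is a dominating set of $G$ if every vertex not in $X$ is adjacent to a vertex in $X$. A dominating set $X$ is a restrained dominating set if every vertex in $V(G)-X$ is adjacent to a vertex in $V(G)-X$; $\gamma_r(G)$ is the minimum cardinality of a restrained dominating set. A restrained dominating set $X$ is a total restrained dominating set if, in addition, every vertex of $X$ is adjacent to a vertex of $X$; $\gamma_{\mathrm{tr}}(G)$ is the minimum cardinality of a total restrained dominating set. *)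

(* Defs.v *)
From HB Require Import structures.
From mathcomp Require Import all_boot all_order all_algebra.
From mathcomp Require Import reals exp.
Set Implicit Arguments.
Unset Strict Implicit.
Unset Printing Implicit Defensive.

(* A simple graph on the vertex set T is a symmetric, irreflexive e : rel T. *)

Definition degree (T : finType) (e : rel T) (x : T) : nat :=
  #|[set y | e x y]|.

(* Degrees are at most #|T|, so the base value of the minimum is harmless on a
   nonempty graph; on the empty graph this is 0. *)
Definition min_degree (T : finType) (e : rel T) : nat :=
  \big[minn/#|T|]_(x : T) degree e x.

Definition edge_set (T : finType) (e : rel T) : {set {set T}} :=
  [set [set p.1; p.2] | p in [pred p : T * T | e p.1 p.2]].

(* Distinct edges are non-adjacent exactly when they share no endpoint. *)
Definition matching (T : finType) (e : rel T) (M : {set {set T}}) : bool :=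
  (M \subset edge_set e) && trivIset M.

Definition matching_number (T : finType) (e : rel T) : nat :=
  \max_(M : {set {set T}} | matching e M) #|M|.

Definition dominating (T : finType) (e : rel T) (X : {set T}) : bool :=
  [forall v in ~: X, exists u in X, e v u].

Definition restrained_dominating (T : finType) (e : rel T) (X : {set T})
    : bool :=
  dominating e X && [forall v in ~: X, exists u in ~: X, e v u].

Definition total_restrained_dominating (T : finType) (e : rel T) (X : {set T})
    : bool :=
  restrained_dominating e X && [forall v in X, exists u in X, e v u].

(* [set: T] is always restrained dominating, and is total restrained dominating
   when there is no isolated vertex; as #|X| <= #|T|, the base value #|T| does
   not affect the minimum below. *)
Definition restrained_domination_number (T : finType) (e : rel T) : nat :=
  \big[minn/#|T|]_(X : {set T} | restrained_dominating e X) #|X|.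

(* On a graph with an isolated vertex there is no total restrained dominating
   set, and the value is the junk value #|T|. *)
Definition total_restrained_domination_number (T : finType) (e : rel T) : nat :=
  \big[minn/#|T|]_(X : {set T} | total_restrained_dominating e X) #|X|.

(* Main.v *)
(** Alon-Spencer: if every set of a family has at least [k] elements, choosing
    each vertex with probability [ln k / k] and adding one element of every set
    that is missed gives a hitting set of expected size at most
    [(n ln k + m) / k], for [n] vertices and [m] sets.  Applied to closed (open)
    neighbourhoods, this yields a small (total) dominating set [D].  Given a
    maximum matching, let [W] be the union of its edges that avoid [D].  Every
    vertex of [W] has a neighbour in [W], its matching partner, and at most
    [#|D|] edges meet [D], so the complement of [W] is a (total) restrained
    dominating set of size at most [n - 2 (beta1 - #|D|)]. *)
Require Import Defs.
From HB Require Import structures.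
From mathcomp Require Import all_boot all_order all_algebra.
From mathcomp Require Import reals sequences exp ring lra zify.
Import Order.TTheory GRing.Theory Num.Theory.
Local Open Scope ring_scope.

Lemma bigminn_le {I : finType} (m : nat) (P : pred I) (F : I -> nat) (i : I) :
  P i -> (\big[minn/m]_(j | P j) F j <= F i)%N.
Proof.
move=> Pi; have: i \in index_enum I by rewrite mem_index_enum.
elim: (index_enum I) => // j s IHs; rewrite inE big_cons.
case/predU1P => [<-|/IHs le_s]; first by rewrite Pi geq_minl.
by case: (P j) => //; rewrite geq_min le_s orbT.
Qed.

Lemma exists_hitting_set {R : realType} {T I : finType} (N : I -> {set T})
    (k : nat) :
  (0 < k)%N -> (forall i, k <= #|N i|)%N ->
  exists D : {set T}, (forall i, ~~ [disjoint D & N i]) /\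
    #|D|%:R <= (ln k%:R * #|T|%:R + #|I|%:R) / k%:R :> R.
Proof.
move=> k_gt0 leN.
have k0 : 0 < k%:R :> R by rewrite ltr0n.
pose p : R := ln k%:R / k%:R.
have p_ge0 : 0 <= p by rewrite divr_ge0 ?ln_ge0 ?ler1n // ltW.
(* The choice of [p] makes [expR (- p) ^+ k], an upper bound for the chance of missing a set of at
   least [k] elements, equal to 1/k. *)
have expRp : expR (- p) ^+ k = k%:R^-1.
  by rewrite -expRM_natl mulrN mulrC mulfVK ?gt_eqF // expRN lnK.
have p_le1 : p <= 1.
  rewrite ler_pdivrMr // mul1r; have := expR_ge1Dx (ln k%:R : R).
  by rewrite lnK ?posrE //; lra.
(* Sums weighted by [w] are expectations over the random set. *)
pose w (S : {set T}) : R := \prod_x (if x \in S then p else 1 - p).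
have w_ge0 S : 0 <= w S.
  by apply: prodr_ge0 => x _; case: ifP => _ //; rewrite subr_ge0.
have sum_w : \sum_(S : {set T}) w S = 1.
  rewrite -(bigA_distr _ _ (fun=> p) (fun=> 1 - p)) big1 // => x _.
  by rewrite /= addrC subrK.
have sum_w_mem x : \sum_(S : {set T}) w S * (x \in S)%:R = p.
  (* Expanded over subsets, this product carries the indicator inside the weights: the factor for
     leaving [x] out is zero. *)
  transitivity (\prod_y (p + (y != x)%:R * (1 - p))).
    rewrite (bigA_distr _ _ (fun=> p) (fun y => (y != x)%:R * (1 - p))).
    apply: eq_bigr => S _; rewrite /w (bigD1 x) //= [RHS](bigD1 x) //= eqxx.
    have -> : \prod_(y | y != x) (if y \in S then p else (y != x)%:R * (1 - p))
        = \prod_(y | y != x) (if y \in S then p else 1 - p).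
      by apply: eq_bigr => y ->; rewrite mul1r.
    by case: (x \in S); rewrite ?mulr1 ?mulr0 ?mul0r.
  rewrite (bigD1 x) //= eqxx mul0r addr0 big1 ?mulr1 // => y ->.
  by rewrite mul1r addrC subrK.
have sum_w_miss (A : {set T}) : (k <= #|A|)%N ->
    \sum_(S : {set T}) w S * [disjoint S & A]%:R <= k%:R^-1.
  move=> leA.
  have -> : \sum_(S : {set T}) w S * [disjoint S & A]%:R = (1 - p) ^+ #|A|.
    (* Likewise, replacing [p] by zero on [A] keeps only the [S] disjoint from [A]. *)
    transitivity (\prod_x ((x \notin A)%:R * p + (1 - p))).
      rewrite (bigA_distr _ _ (fun x => (x \notin A)%:R * p) (fun=> 1 - p)).
      apply: eq_bigr => S _; case: (boolP [disjoint S & A]) => [dis|].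
        rewrite mulr1; apply: eq_bigr => x _; case: ifP => // xS.
        by rewrite (disjointFr dis xS) mul1r.
      rewrite disjoint_sym => /pred0Pn[x /andP[/= xA xS]].
      by rewrite mulr0 (bigD1 x) //= xS xA !mul0r.
    rewrite (bigID (mem A)) /= -prodr_const.
    rewrite [X in _ * X]big1 ?mulr1 => [|x ->]; last first.
      by rewrite mul1r addrC subrK.
    by apply: eq_bigr => x ->; rewrite mul0r add0r.
  rewrite -expRp.
  have q_ge0 : 0 <= 1 - p by rewrite subr_ge0.
  (* As [1 - p] lies in [0, 1], lowering the exponent to [k] can only increase the power; then
     [1 - p <= expR (- p)]. *)
  apply: (@le_trans _ _ ((1 - p) ^+ k)).
    by apply: ler_wiXn2l => //; lra.
  by rewrite lerXn2r ?nnegrE ?expR_ge0 // expR_ge1Dx.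
(* Repairing [S] adds at most one vertex per missed set, so [cost S] bounds the size of the repaired
   set. *)
pose cost (S : {set T}) : R := #|S|%:R + #|[set i | [disjoint S & N i]]|%:R.
pose bound : R := (ln k%:R * #|T|%:R + #|I|%:R) / k%:R.
have mean : \sum_S w S * cost S <= bound.
  have cardE (J : finType) (A : {set J}) : #|A|%:R = \sum_x (x \in A)%:R :> R.
    by rewrite -sum1_card natr_sum big_mkcond; apply: eq_bigr => x _; case: ifP.
  under eq_bigr => S _ do rewrite /cost !cardE mulrDr !mulr_sumr.
  rewrite big_split /= exchange_big [X in _ + X <= _]exchange_big /=.
  under eq_bigr => x _ do rewrite sum_w_mem.
  have -> : bound = \sum_(x : T) p + \sum_(i : I) k%:R^-1.
    rewrite !sumr_const /bound -[p *+ _]mulr_natr -[_^-1 *+ _]mulr_natr.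
    by rewrite /p mulrDl mulrAC [_^-1 * _]mulrC.
  rewrite lerD2l; apply: ler_sum => i _.
  under eq_bigr => S _ do rewrite inE.
  exact: sum_w_miss.
(* Some set does no worse than the mean. Otherwise all terms [w S * (cost S - bound)] are
   nonnegative with sum at most 0, hence vanish; as [cost S] always exceeds [bound], every weight is
   0, against [sum_w]. *)
have [S leS] : exists S, cost S <= bound.
  case: (pickP (fun S => cost S <= bound)) => [S leS|gtS]; first by exists S.
  have w0 S : w S = 0.
    have d_ge0 S' : 0 <= w S' * (cost S' - bound).
      by rewrite mulr_ge0 // subr_ge0 ltW // ltNge gtS.
    have: \sum_S' w S' * (cost S' - bound) <= 0.
      under eq_bigr => S' _ do rewrite mulrBr.
      by rewrite sumrB -mulr_suml sum_w mul1r subr_le0.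
    rewrite le_eqVlt ltNge sumr_ge0 // orbF psumr_eq0 // => /allP/(_ S).
    rewrite mem_index_enum => /(_ isT); rewrite mulf_eq0 subr_eq0.
    case/orP => /eqP // eqS; have := gtS S; by rewrite eqS lexx.
  by move: sum_w; rewrite big1 // => /eqP; rewrite eq_sym oner_eq0.
have exN i : exists x, x \in N i.
  by apply/card_gt0P; apply: leq_trans (leN i).
pose r i := xchoose (exN i).
exists (S :|: r @: [set i | [disjoint S & N i]]); split=> [i|].
  case: (boolP [disjoint S & N i]) => [dis|].
    apply/pred0Pn; exists (r i) => /=.
    by rewrite inE imset_f ?inE // orbT; apply: (xchooseP (exN i)).
  by apply: contra; apply: disjointWl; apply/subsetP => x xS; rewrite inE xS.
apply: le_trans leS; rewrite /cost -natrD ler_nat cardsU.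
by rewrite (leq_trans (leq_subr _ _)) // leq_add2l leq_imset_card.
Qed.

(** Domination, plain or total, passes to supersets, so [D \subset X] is all that has to be kept of
    [D]. The last inequality is additive because subtraction on [nat] truncates. *)
Lemma exists_matching_complement {T : finType} (e : rel T) (D : {set T}) :
  symmetric e -> irreflexive e ->
  exists X : {set T}, [/\ D \subset X,
    forall v, v \notin X -> exists2 u, u \notin X & e v u &
    (#|X| + 2 * matching_number e <= #|T| + 2 * #|D|)%N].
Proof.
move=> e_sym e_irr.
have [M Mm MM] : exists2 M, matching e M & matching_number e = #|M|.
  have m0 : matching e set0.
    rewrite /matching sub0set; apply/trivIsetP => A B; by rewrite inE.
  have := @eq_bigmax_cond _ (matching e) (fun M => #|M|).
  case; first by apply/card_gt0P; exists set0.
  by move=> M Mm ?; exists M.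
case/andP: Mm => /subsetP Me tM.
pose G := [set m in M | [disjoint m & D]].
have GM : G \subset M by apply/subsetP => m; rewrite inE => /andP[].
have card2 m : m \in M -> #|m| = 2.
  move=> /Me/imsetP[[x y]]; rewrite inE /= => exy ->.
  by rewrite cards2; case: eqP exy => // ->; rewrite e_irr.
have cardW : #|cover G| = (2 * #|G|)%N.
  have /eqP <- : trivIset G by apply: trivIsetS tM.
  rewrite mulnC -sum_nat_const; apply: eq_bigr => m /(subsetP GM).
  exact: card2.
(* Edges of [M] are disjoint, so one that meets [D] at [x] is [pblock M x]: these edges all lie in
   the image of [D]. *)
have bad : (#|M :\: G| <= #|D|)%N.
  apply: leq_trans (leq_imset_card (pblock M) D); apply/subset_leq_card/subsetP.
  move=> m; rewrite !inE => /andP[+ mM]; rewrite mM /=.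
  case/pred0Pn=> x /andP[/= xm xD].
  by apply/imsetP; exists x => //; rewrite (def_pblock tM mM xm).
exists (~: cover G); split.
- apply/subsetP => x xD; rewrite inE; apply/bigcupP => -[m].
  by rewrite inE => /andP[_ /disjointFr dis] /dis; rewrite xD.
- move=> v; rewrite inE negbK => /bigcupP[m mG vm].
  have /imsetP[[x y]] := Me m (subsetP GM m mG); rewrite inE /= => exy mE.
  have inW u : u \in m -> u \notin ~: cover G.
    by move=> um; rewrite inE negbK; apply/bigcupP; exists m.
  move: vm; rewrite mE !inE => /orP[]/eqP->.
    by exists y => //; apply: inW; rewrite mE !inE eqxx orbT.
  by exists x; [apply: inW; rewrite mE !inE eqxx | rewrite e_sym].
- have := cardsC (cover G); rewrite cardW MM.
  have := cardsID G M; rewrite (setIidPr GM) => <-.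
  by move: bad; lia.
Qed.

Theorem theorem15 (R : realType) (T : finType) (e : rel T)
    (e_sym : symmetric e) (e_irr : irreflexive e)
    (n delta beta1 : nat)
    (n_def : n = #|T|)
    (delta_def : delta = min_degree e)
    (delta_gt0 : (0 < delta)%N)
    (beta1_def : beta1 = matching_number e) :
  (restrained_domination_number e)%:R
    <= (2 * ln (delta%:R + 1) + delta%:R + 3) / (delta%:R + 1) * n%:R
       - 2 * beta1%:R :> R
  /\
  (total_restrained_domination_number e)%:R
    <= (2 * ln delta%:R + delta%:R + 2) / delta%:R * n%:R
       - 2 * beta1%:R :> R.
Proof.
have deg v : (delta <= #|[set u | e v u]|)%N.
  by rewrite delta_def; apply: (@bigminn_le _ _ xpredT (degree e)).
(* Serves both inequalities, with [k] equal to [delta.+1] and then [delta]. One neighbourhood per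
   vertex makes the number of sets [#|T|]. *)
have bound (k g : nat) (D X : {set T}) : (0 < k)%N -> (g <= #|X|)%N ->
    #|D|%:R <= (ln k%:R * #|T|%:R + #|T|%:R) / k%:R :> R ->
    (#|X| + 2 * matching_number e <= #|T| + 2 * #|D|)%N ->
    g%:R <= (2 * ln k%:R + k%:R + 2) / k%:R * n%:R - 2 * beta1%:R :> R.
  rewrite -n_def -beta1_def -(ltr0n R) -(ler_nat R) => k_gt0 gX leD.
  rewrite -(ler_nat R) !(natrM, natrD) => leX.
  have -> : (2 * ln k%:R + k%:R + 2) / k%:R * n%:R
      = 2 * ((ln k%:R * n%:R + n%:R) / k%:R) + n%:R :> R.
    by field; rewrite gt_eqF.
  lra.
split.
- pose N v := v |: [set u | e v u].
  have N_deg v : (delta.+1 <= #|N v|)%N.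
    by rewrite cardsU1 inE e_irr /= add1n ltnS deg.
  have [D [hitD cardD]] := @exists_hitting_set R _ _ N _ (ltn0Sn delta) N_deg.
  have [X [DX XW cardX]] := exists_matching_complement e D e_sym e_irr.
  have domX : restrained_dominating e X.
    apply/andP; split; apply/forall_inP => v; rewrite inE => vX.
      have /pred0Pn[u /andP[/= uD]] := hitD v; rewrite !inE.
      have uX := subsetP DX u uD.
      (* A closed neighbourhood may be hit at [v] itself, but then [v] would lie in [D], hence in
         [X]. *)
      case/predU1P => [uv|evu]; first by rewrite -uv uX in vX.
      by apply/exists_inP; exists u.
    have [u uX evu] := XW v vX.
    by apply/exists_inP; exists u; rewrite // inE.
  have -> : 2 * ln (delta%:R + 1) + delta%:R + 3
      = 2 * ln delta.+1%:R + delta.+1%:R + 2 :> R by rewrite natr1 -natr1; lra.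
  rewrite natr1; apply: (bound _ _ D X (ltn0Sn delta) _ cardD cardX).
  exact: bigminn_le.
- have [D [hitD cardD]] := @exists_hitting_set R _ _ _ _ delta_gt0 deg.
  have [X [DX XW cardX]] := exists_matching_complement e D e_sym e_irr.
  (* Open neighbourhoods are hit for [v] inside [X] as well as outside, which gives totality and
     domination at once. *)
  have adjX v : [exists u in X, e v u].
    have /pred0Pn[u /andP[/= uD]] := hitD v; rewrite inE => evu.
    by apply/exists_inP; exists u; rewrite // (subsetP DX).
  apply: (bound _ _ D X delta_gt0 _ cardD cardX).
  apply: bigminn_le.
  apply/andP; split; last by apply/forall_inP.
  apply/andP; split; apply/forall_inP => v; rewrite inE => vX //.
  have [u uX evu] := XW v vX.
  by apply/exists_inP; exists u; rewrite // inE.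
Qed.
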